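(* Let $d$ and $k$ be integers with $2\le k\le d-1$. Then $\underline{sa}_d^s(d+k)$ satisfies the following upper bounds. (1) For $2 \leq k \leq \lfloor (2d-2)/3 \rfloor$ we have $$\underline{sa}_d^s(d+k) \leq \frac{d(d+1)}{2}+k-1 = \Theta(d^2).$$ (2) For $\lceil (2d-2)/3 \rceil \leq k \leq d-1$ we have $$\underline{sa}_d^s(d+k) \leq k + \frac{(d+k)(d+k-1)}{2} - \frac{2k(2k-1)}{2} = k + \frac{(d-k)(d+3k-1)}{2} = \Theta((d-k)d).$$
   Context: Let $X=\{x_1,\dots,x_n\}\subset\mathbb{R}^d$ be a finite set (with $x_i\neq x_j$ for $i\ne j$) whose affine hull is $\mathbb{R}^d$, and let $P=\operatorname{conv}X$. Two distinct points $x_i,x_j\in X$ are strictly antipodal (in $X$) if there are different parallel supporting hyperplanes $H',H''$ of $P$ with $X\cap H'=\{x_i\}$ and $X\cap H''=\{x_j\}$. $sa(X)$ is the number of (unordered) strictly antipodal pairs of $X$. $X$ is in strictly convex position if $X=\operatorname{vert}P$ (the vertex set of $P$). $\mathcal{C}_d^s(n)$ is the family of all $X\subset\mathbb{R}^d$ with $|X|=n$, $\operatorname{aff}X=\mathbb{R}^d$, $X$ in strictly convex position, and $\underline{sa}_d^s(n):=\min\{sa(X)\mid X\in\mathcal{C}_d^s(n)\}$. The $\Theta(\cdot)$ relations mean that the displayed explicit expressions lie between positive absolute constant multiples of the indicated quantities, over the stated range of $d,k$. *)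

(* Defs.v *)
From mathcomp Require Import all_boot all_order all_algebra.
From mathcomp Require Import finmap.
From mathcomp Require Import boolp classical_sets reals convex.
Set Implicit Arguments.
Unset Strict Implicit.
Unset Printing Implicit Defensive.
Import Order.TTheory GRing.Theory Num.Theory.
Local Open Scope classical_set_scope.
Local Open Scope ring_scope.

Section ConvexGeometry.
Variables (R : realType) (d : nat).
Implicit Types (u x y : 'rV[R]_d) (c : R) (A P H : set 'rV[R]_d).
Implicit Type X : {fset 'rV[R]_d}.

Definition affine_set A : Prop :=
  forall x y (t : R), A x -> A y -> A ((1 - t) *: x + t *: y).

Definition affine_hull A : set 'rV[R]_d := smallest affine_set A.

Definition convex_hull A : set 'rV[R]_d :=
  smallest (fun C : set 'rV[R]_d => convex_set C) A.

Definition dot u x : R := \sum_i u 0 i * x 0 i.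

(* A hyperplane is [hyperplane u c] with [u != 0]; for [u = 0] this set is
   empty or everything, so [u != 0] is required wherever it is used. *)
Definition hyperplane u c : set 'rV[R]_d := [set x | dot u x = c].

(* One sign suffices: [hyperplane u c = hyperplane (- u) (- c)]. *)
Definition supporting_hyperplane P H : Prop :=
  exists u c, [/\ u != 0, H = hyperplane u c,
    P `<=` [set x | dot u x <= c] & P `&` H !=set0].

Definition parallel_hyperplanes H H' : Prop :=
  exists u c c', [/\ u != 0, H = hyperplane u c & H' = hyperplane u c'].

(* The vertices of a polytope are its 0-dimensional faces. *)
Definition vert P : set 'rV[R]_d :=
  [set x | exists2 H, supporting_hyperplane P H & P `&` H = [set x]].

Definition strictly_antipodal X x y : Prop :=
  [/\ x \in X, y \in X, x != y &
    exists H' H'', let P := convex_hull [set` X] in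
      [/\ supporting_hyperplane P H', supporting_hyperplane P H'',
          parallel_hyperplanes H' H'' & H' <> H''] /\
      [set` X] `&` H' = [set x] /\ [set` X] `&` H'' = [set y]].

(* Unordered pairs are represented by the subsets [{x, y}] of [X]. *)
Definition sa X : nat :=
  #|` [fset e in fpowerset X |
        `[< exists x y, e = [fset x; y]%fset /\ strictly_antipodal X x y >]]%fset|.

Definition strictly_convex_position X : Prop :=
  [set` X] = vert (convex_hull [set` X]).

(* The family $\mathcal{C}_d^s(n)$. *)
Definition Cs (n : nat) : set {fset 'rV[R]_d} :=
  [set X | [/\ #|` X| = n, affine_hull [set` X] = setT & strictly_convex_position X]].

End ConvexGeometry.

Arguments Cs : clear implicits.

(* The minimum of [sa] over [Cs n]; when [Cs n] is empty this is the
   meaningless value 0, so that statements about [sa_min] should be accompanied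
   by the nonemptiness of [Cs n]. *)
Definition sa_min (R : realType) (d n : nat) : nat :=
  let S := [set sa X | X in Cs R d n] in xget 0%N (S `&` lbound S).

(* [f = Theta(g)] uniformly over all pairs [(d, k)] in the domain [D]. *)
Definition Theta_on (R : realType) (D : nat -> nat -> Prop)
    (f g : nat -> nat -> R) : Prop :=
  exists a b : R, [/\ 0 < a, 0 < b &
    forall d k, D d k -> a * g d k <= f d k <= b * g d k].

Arguments Theta_on : clear implicits.

Definition k_range_low (R : realType) (d k : nat) : Prop :=
  (2 <= k <= d - 1)%N /\ k%:Z <= Num.floor ((2 * d%:R - 2) / 3 : R).

Definition k_range_high (R : realType) (d k : nat) : Prop :=
  (2 <= k <= d - 1)%N /\ Num.ceil ((2 * d%:R - 2) / 3 : R) <= k%:Z.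

(* Main.v *)
(* Both bounds come from explicit configurations.

   For (2), take the cross-polytope with vertices e_i, - e_i (i < k) and the
   remaining e_j as apexes of an iterated pyramid.  If u is strictly maximal at x
   and strictly minimal at y, for x, y vertices of the cross-polytope with y <> - x,
   then u.x > u.(-y) and u.y < u.(-x) contradict each other; so of the C(2k, 2)
   pairs of vertices of the cross-polytope only k are strictly antipodal.

   For (1), take the simplex on 0, e_1, .., e_d and, just beyond k - 1 of its
   facets, the points (1, .., 1)/d - (2/d) e_i.  Such a point is so close to the
   facet opposite to e_i that it is strictly antipodal at most to e_i, so there
   are at most C(d+1, 2) + (k - 1) strictly antipodal pairs. *)
Require Import Defs.
From mathcomp Require Import all_boot all_order all_algebra.
From mathcomp Require Import finmap.
From mathcomp Require Import boolp classical_sets reals convex.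
From mathcomp Require Import zify ring lra.
Set Implicit Arguments.
Unset Strict Implicit.
Import Order.TTheory GRing.Theory Num.Theory.
Local Open Scope classical_set_scope.
Local Open Scope ring_scope.

(** * Linear functionals, hulls, vertices and strict antipodality *)

Section Dot.
Context {R : realType} {d : nat}.
Implicit Types u x y : 'rV[R]_d.

Lemma dotD u x y : dot u (x + y) = dot u x + dot u y.
Proof.
by rewrite /dot -big_split/=; apply: eq_bigr => i _; rewrite mxE mulrDr.
Qed.

Lemma dotZ u (a : R) x : dot u (a *: x) = a * dot u x.
Proof. by rewrite /dot mulr_sumr; apply: eq_bigr => i _; rewrite mxE mulrCA. Qed.

Lemma dotN u x : dot u (- x) = - dot u x.
Proof. by rewrite -scaleN1r dotZ mulN1r. Qed.

Lemma dot0r u : dot u 0 = 0.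
Proof. by rewrite -(scale0r 0) dotZ mul0r. Qed.

Lemma dotZl u (a : R) x : dot (a *: u) x = a * dot u x.
Proof. by rewrite /dot mulr_sumr; apply: eq_bigr => i _; rewrite mxE mulrA. Qed.

Lemma dot_delta u i : dot u (delta_mx 0 i) = u 0 i.
Proof.
rewrite /dot (bigD1 i)//= mxE !eqxx mulr1 big1 ?addr0// => j ji.
by rewrite mxE (negPf ji) mulr0.
Qed.

Lemma dot_const u (a : R) : dot u (const_mx a) = a * \sum_i u 0 i.
Proof. by rewrite /dot mulr_sumr; apply: eq_bigr => i _; rewrite mxE mulrC. Qed.

Lemma dot_self_gt0 u : u != 0 -> 0 < dot u u.
Proof.
move=> u0; have [i ui] : exists i, u 0 i != 0.
  apply/existsP; apply: contraNT u0; rewrite negb_exists => /forallP h.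
  by apply/eqP/rowP => i; rewrite mxE; have /negPn/eqP := h i.
rewrite /dot (bigD1 i)//= -expr2 ltr_wpDr ?exprn_even_gt0//.
by apply: sumr_ge0 => j _; rewrite -expr2 sqr_ge0.
Qed.

(** Moving a point of the hyperplane along the kernel of [dot u] keeps it in the hyperplane, so
    [dot v] vanishes on that kernel and is a multiple of [dot u]. *)
Lemma hyperplane_dot u v (b c : R) : u != 0 -> v != 0 ->
  hyperplane u b = hyperplane v c -> exists2 t, t != 0 & forall x, dot v x = t * dot u x.
Proof.
move=> u0 v0 uv.
have uu := dot_self_gt0 u0; have uu0 := lt0r_neq0 uu.
pose x0 := (b / dot u u) *: u.
have hx0 : dot u x0 = b by rewrite dotZ divfK.
have vx0 : dot v x0 = c.
  by have : hyperplane u b x0 by []; rewrite uv.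
have vw w : dot u w = 0 -> dot v w = 0.
  move=> uw; have : hyperplane u b (x0 + w) by rewrite /hyperplane/= dotD hx0 uw addr0.
  by rewrite uv /hyperplane/= dotD vx0; lra.
have vE x : dot v x = dot v u / dot u u * dot u x.
  have := vw (x - (dot u x / dot u u) *: u).
  rewrite !(dotD, dotN, dotZ) divfK// subrr => /(_ erefl)/eqP.
  by rewrite subr_eq0 => /eqP->; ring.
exists (dot v u / dot u u) => //.
apply: contraTneq (dot_self_gt0 v0) => t0.
by rewrite vE t0 mul0r ltxx.
Qed.

Lemma convex_setP (A : set 'rV[R]_d) :
  (forall x y (t : R), A x -> A y -> 0 < t < 1 -> A (t *: x + (1 - t) *: y)) ->
  convex_set A.
Proof.
move=> h; apply/convex_setW => x y /set_mem Ax /set_mem Ay l l0 l1.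
by apply/mem_set; apply: h => //; apply/andP.
Qed.

Lemma convex_halfspace u (c : R) : convex_set [set x : 'rV[R]_d | dot u x < c].
Proof.
apply: convex_setP => x y t /= xc yc /andP[t0 t1].
rewrite dotD !dotZ; nra.
Qed.

(** Serves to show that a hull meets a hyperplane in [z] alone: this set contains the hull as soon
    as it contains the generating points. *)
Lemma convex_halfspaceU1 u z :
  convex_set [set x : 'rV[R]_d | dot u x < dot u z \/ x = z].
Proof.
apply: convex_setP => x y t /= xc yc /andP[t0 t1].
have [->|xz] := eqVneq x z; have [->|yz] := eqVneq y z.
- by right; rewrite -scalerDl addrC subrK scale1r.
- left; case: yc yz => [yc _|->]; last by rewrite eqxx.
  rewrite dotD !dotZ; nra.
- left; case: xc xz => [xc _|->]; last by rewrite eqxx.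
  rewrite dotD !dotZ; nra.
- left; case: xc xz => [xc _|->]; last by rewrite eqxx.
  case: yc yz => [yc _|->]; last by rewrite eqxx.
  rewrite dotD !dotZ; nra.
Qed.

Lemma sub_convex_hull (A : set 'rV[R]_d) : A `<=` convex_hull A.
Proof. exact: sub_gen_smallest. Qed.

Lemma convex_hull_sub (A C : set 'rV[R]_d) :
  convex_set C -> A `<=` C -> convex_hull A `<=` C.
Proof. by move=> *; apply: smallest_sub. Qed.

(** If [x] were not in [A], all of [A] would lie in the open half-space below the supporting
    hyperplane at [x], and so would the hull, including [x]. *)
Lemma vert_convex_hull_sub (A : set 'rV[R]_d) : vert (convex_hull A) `<=` A.
Proof.
move=> x [H [u [c [u0 -> Pc _]]] PH]; apply: contrapT => Ax.
have [Px xc] : (convex_hull A `&` hyperplane u c) x by rewrite PH.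
suff : [set y : 'rV[R]_d | dot u y < c] x by rewrite /= xc ltxx.
apply: (convex_hull_sub (@convex_halfspace u c) _ Px) => z Az /=.
rewrite lt_neqAle Pc ?andbT; last exact: sub_convex_hull.
apply/eqP => zc; suff zx : z = x by rewrite -zx in Ax.
suff : (convex_hull A `&` hyperplane u c) z by rewrite PH.
by split => //; exact: sub_convex_hull.
Qed.

Lemma exposed_vert (A : set 'rV[R]_d) u x : u != 0 -> A x ->
  (forall y, A y -> y <> x -> dot u y < dot u x) -> vert (convex_hull A) x.
Proof.
move=> u0 Ax ux.
have Plt y : convex_hull A y -> [set z : 'rV[R]_d | dot u z < dot u x \/ z = x] y.
  move=> Py; apply: (convex_hull_sub (@convex_halfspaceU1 u x) _ Py) => z Az /=.
  by have [->|/eqP zx] := eqVneq z x; [right|left; exact: ux].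
exists (hyperplane u (dot u x)).
  exists u, (dot u x); split=> //; last by exists x; split => //; exact: sub_convex_hull.
  by move=> y /Plt[/ltW|->] /=.
apply/seteqP; split=> [y [/Plt[yx|//] /= yE]|_ ->].
  by move: yx; rewrite yE ltxx.
by split => //; exact: sub_convex_hull.
Qed.

(** An affine set through 0 is a linear subspace: scaling follows the line through 0, and a sum is
    twice a midpoint. *)
Lemma affine_hull_basis (A : set 'rV[R]_d) :
  affine_hull A 0 -> (forall i, affine_hull A (delta_mx 0 i)) ->
  affine_hull A = setT.
Proof.
move=> A0 Ae; apply/seteqP; split=> // x _ B [Baff AB].
have B0 : B 0 by apply: A0.
have BZ t y : B y -> B (t *: y).
  by move=> By; have := Baff 0 y t B0 By; rewrite scaler0 add0r.
have BD y z : B y -> B z -> B (y + z).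
  move=> By Bz; have := BZ 2 _ (Baff y z 2^-1 By Bz).
  rewrite scalerDr !scalerA (_ : 2 * (1 - 2^-1) = 1 :> R); last lra.
  by rewrite divff ?pnatr_eq0// !scale1r.
rewrite (row_sum_delta x); elim/big_ind: _ => // i _.
by apply: BZ; apply: Ae.
Qed.

(** Parallel hyperplanes have proportional normals, so the functional [u] supporting at [x] serves
    at [y] too, up to a factor [t]. *)
Lemma strictly_antipodal_dot (X : {fset 'rV[R]_d}) x y :
  strictly_antipodal X x y -> exists u,
    (forall z, z \in X -> z != x -> dot u z < dot u x) /\
    (forall z, z \in X -> z != y -> dot u y < dot u z).
Proof.
move=> [xX yX xy [H' [H'' /= [[sH' sH'' pH nH] [XH' XH'']]]]].
case: sH' sH'' pH => u [c [u0 H'E Pc _]] [v [b [v0 H''E Pb _]]].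
move=> [w [a [a' [w0 H'w H''w]]]].
have [t t0 tE] : exists2 t, t != 0 & forall x, dot v x = t * dot u x.
  have [r r0 rE] := hyperplane_dot u0 w0 (etrans (esym H'E) H'w).
  have [s s0 sE] := hyperplane_dot w0 v0 (etrans (esym H''w) H''E).
  by exists (s * r); [rewrite mulf_neq0|move=> z; rewrite sE rE mulrA].
have xc : dot u x = c.
  have : ([set` X] `&` H') x by rewrite XH'.
  by rewrite H'E => -[].
have yb : dot v y = b.
  have : ([set` X] `&` H'') y by rewrite XH''.
  by rewrite H''E => -[].
have ux z : z \in X -> z != x -> dot u z < dot u x.
  move=> zX zx; rewrite xc lt_neqAle Pc ?andbT; last exact: sub_convex_hull.
  apply: contra zx => /eqP zc; apply/eqP.
  suff : ([set` X] `&` H') z by rewrite XH'.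
  by rewrite H'E.
have vy z : z \in X -> z != y -> dot v z < dot v y.
  move=> zX zy; rewrite yb lt_neqAle Pb ?andbT; last exact: sub_convex_hull.
  apply: contra zy => /eqP zc; apply/eqP.
  suff : ([set` X] `&` H'') z by rewrite XH''.
  by rewrite H''E.
exists u; split => // z zX zy.
have := vy _ xX xy; have := vy _ zX zy; rewrite !tE.
(* A positive [t] would make both [x] and [y] the strict maximum of [u]; hence [t] is negative and
   [y] is the minimum. *)
have [tn|tp|t00] := ltgtP t 0; last by rewrite t00 eqxx in t0.
  by rewrite ltr_nM2l.
rewrite !ltr_pM2l// => _.
by rewrite ltNge ltW// ux// eq_sym.
Qed.

End Dot.

(** * Finite families whose members are each exposed by a functional *)

Section Family.
Context {R : realType} {d : nat} {I : finType}.
Variable g : I -> 'rV[R]_d.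
Hypothesis exposed_g :
  forall i, exists u, forall j, j != i -> dot u (g j) < dot u (g i).

Definition points : {fset 'rV[R]_d} := [fset g i | i in I]%fset.

Lemma exposed_inj : injective g.
Proof.
move=> i j gij; apply/eqP; apply: contraT => ij.
by have [u /(_ _ ij)] := exposed_g j; rewrite gij ltxx.
Qed.

Lemma mem_points i : g i \in points.
Proof. by apply/imfsetP; exists i. Qed.

Lemma pointsP x : x \in points -> exists i, x = g i.
Proof. by move=> /imfsetP[i _ ->]; exists i. Qed.

Lemma points_Cs : (1 < #|I|)%N -> affine_hull (range g) = setT ->
  Cs R d #|I| points.
Proof.
move=> I1 gT; split.
- by rewrite card_imfset ?cardE //; exact: exposed_inj.
- rewrite -gT; congr affine_hull; apply/seteqP; split=> x /=.
    by move=> /pointsP[i ->]; exists i.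
  by move=> [i _ <-]; exact: mem_points.
- apply/seteqP; split; last exact: vert_convex_hull_sub.
  move=> _ /pointsP[i ->]; have [u ui] := exposed_g i.
  apply: (@exposed_vert _ _ _ u); last 2 first.
  + exact: mem_points.
  + move=> _ /pointsP[j ->] ji; apply: ui.
    by apply: contra_notN ji => /eqP->.
  (* The exposing functional is nonzero because it separates [g i] from a second member of the
     family. *)
  apply: contraPneq ui => u0 ui.
  have /card_gt1P[j1 [j2 [_ _ j12]]] := I1.
  have [j ji] : exists j, j != i.
    have [ji|] := eqVneq j1 i; last by exists j1.
    by exists j2; rewrite -ji eq_sym.
  have := ui _ ji; rewrite u0 -(scale0r 0) !dotZl !mul0r ltxx.
  by [].
Qed.

(** Moves the count from pairs of points to pairs of indices: every strictly antipodal pair is the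
    image under [g] of a member of [E]. *)
Lemma sa_points_le (E : {set {set I}}) :
  (forall i j u, i != j ->
     (forall l, l != i -> dot u (g l) < dot u (g i)) ->
     (forall l, l != j -> dot u (g j) < dot u (g l)) -> [set i; j]%SET \in E) ->
  (sa points <= #|E|)%N.
Proof.
move=> hE.
pose im (A : {set I}) : {fset 'rV[R]_d} := [fset g i | i in A]%fset.
apply: (@leq_trans #|` [fset im A | A in E]%fset|); last first.
  by apply: leq_trans (leq_imfset_card _ _ _) _; rewrite /= -cardE.
apply/fsubset_leq_card/fsubsetP => e; rewrite !inE /= => /andP[_ /asboolP].
move=> [x [y [-> xy]]]; apply/imfsetP => /=.
have [u [ux uy]] := strictly_antipodal_dot xy.
case: xy => /pointsP[i xi] /pointsP[j yj] xy _; subst x y.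
exists [set i; j]%SET.
  apply: (hE i j u); first by apply: contra xy => /eqP->.
  - by move=> l li; apply: ux; [exact: mem_points|rewrite (inj_eq exposed_inj)].
  - by move=> l lj; apply: uy; [exact: mem_points|rewrite (inj_eq exposed_inj)].
apply/fsetP => z; rewrite !inE; apply/idP/imfsetP => /=.
  by move=> /orP[] /eqP ->; [exists i|exists j]; rewrite ?finset.in_set2 ?eqxx ?orbT.
by move=> [l + ->]; rewrite finset.in_set2 => /orP[] /eqP ->; rewrite eqxx ?orbT.
Qed.

End Family.

Lemma sa_min_le (R : realType) (d n : nat) (X : {fset 'rV[R]_d}) :
  Cs R d n X -> (sa_min R d n <= sa X)%N.
Proof.
(* In the default case of [xget] the value is 0 and the bound is trivial. *)
move=> CX; rewrite /sa_min; case: xgetP => //= m _ [_ /(_ (sa X))].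
by apply; exists X.
Qed.

Lemma affine_hull0_opp {R : realType} {d : nat} (A : set 'rV[R]_d) x :
  A x -> A (- x) -> affine_hull A 0.
Proof.
move=> Ax ANx B [Baff AB]; have := Baff x (- x) 2^-1 (AB _ Ax) (AB _ ANx).
by rewrite scalerN -scalerBl (_ : 1 - 2^-1 - 2^-1 = 0 :> R) ?scale0r//; lra.
Qed.

(** * Iterated pyramids over a cross-polytope *)

Section CrossPolytopePyramid.
Variables (R : realType) (d k : nat).
Hypotheses (k0 : (0 < k)%N) (kd : (k <= d)%N).

Definition cross_pyramid (s : 'I_d + 'I_k) : 'rV[R]_d :=
  match s with
  | inl i => delta_mx 0 i
  | inr j => - delta_mx 0 (widen_ord kd j)
  end.

(** Each point is its own exposing functional: its product with itself is 1, with any other point 0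
    or -1. *)
Lemma cross_pyramid_exposed s : exists u, forall t, t != s ->
  dot u (cross_pyramid t) < dot u (cross_pyramid s).
Proof.
exists (cross_pyramid s) => t.
case: s => [i|i]; case: t => [j|j] /= ts; rewrite ?dotN !dot_delta !mxE !eqxx /=.
- have ji : j != i by apply: contra ts => /eqP->.
  by rewrite (negPf ji) ltr01.
- by case: (_ == _) => /=; rewrite ?mulr1n ?mulr0n; lra.
- by case: (_ == _) => /=; rewrite ?mulr1n ?mulr0n; lra.
- have ji : j != i by apply: contra ts => /eqP->.
  by rewrite -val_eqE /= val_eqE (negPf ji) mulr0n; lra.
Qed.

Let X : {fset 'rV[R]_d} := points cross_pyramid.

Lemma cross_pyramid_Cs : Cs R d (d + k) X.
Proof.
have -> : (d + k)%N = #|{: 'I_d + 'I_k}| by rewrite card_sum !card_ord.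
apply: points_Cs; first exact: cross_pyramid_exposed.
  by rewrite card_sum !card_ord; lia.
apply: affine_hull_basis.
  apply: (@affine_hull0_opp _ _ _ (cross_pyramid (inl (widen_ord kd (Ordinal k0))))).
    by exists (inl (widen_ord kd (Ordinal k0))).
  by exists (inr (Ordinal k0)).
by move=> i; apply: sub_gen_smallest; exists (inl i).
Qed.

(** Indexes the vertices of the cross-polytope within the whole family, leaving out the apexes. *)
Let base (s : 'I_k + 'I_k) : 'I_d + 'I_k :=
  match s with inl j => inl (widen_ord kd j) | inr j => inr j end.

Let opp (s : 'I_k + 'I_k) : 'I_k + 'I_k :=
  match s with inl j => inr j | inr j => inl j end.

Let oppK : involutive opp. Proof. by case. Qed.

Let base_inj : injective base.
Proof.
move=> [a|a] [b|b] //= [ab]; congr (_ _) => //.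
exact/val_inj.
Qed.

Let cross_pyramid_opp s : cross_pyramid (base (opp s)) = - cross_pyramid (base s).
Proof. by case: s => j //=; rewrite opprK. Qed.

Lemma sa_cross_pyramid : (sa X <= 'C(d + k, 2) - 'C(2 * k, 2) + k)%N.
Proof.
(* [T] holds all pairs, [TJ] the pairs inside the cross-polytope, [D] its [k] diagonals. A strictly
   antipodal pair lies in [T] minus [TJ] or in [D]. *)
pose J : {set 'I_d + 'I_k} := (base @: [set: 'I_k + 'I_k])%SET.
pose T : {set {set 'I_d + 'I_k}} := [set A : {set 'I_d + 'I_k} | #|A| == 2]%SET.
pose TJ : {set {set 'I_d + 'I_k}} :=
  [set A : {set 'I_d + 'I_k} | (A \subset J) && (#|A| == 2)]%SET.
pose D : {set {set 'I_d + 'I_k}} :=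
  [set [set inl (widen_ord kd j); inr j]%SET | j : 'I_k]%SET.
have cJ : #|J| = (2 * k)%N.
  by rewrite card_imset// cardsT card_sum card_ord mul2n addnn.
have cT : #|T| = 'C(d + k, 2) by rewrite card_draws card_sum !card_ord.
have cTJ : #|TJ| = 'C(2 * k, 2) by rewrite cards_draws cJ.
have cTD : #|(T :\: TJ)%SET| = ('C(d + k, 2) - 'C(2 * k, 2))%N.
  rewrite cardsD cT (_ : T :&: TJ = TJ)%SET ?cTJ//.
  by apply/finset.setIidPr/fintype.subsetP => A; rewrite !finset.inE => /andP[].
have cD : (#|D| <= k)%N by rewrite -[leqRHS]card_ord; exact: leq_imset_card.
apply: (@leq_trans #|((T :\: TJ) :|: D)%SET|); last first.
  rewrite cardsU (leq_trans (leq_subr _ _))// cTD.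
  by rewrite leq_add2l.
apply: sa_points_le; first exact: cross_pyramid_exposed.
move=> i j u ij ui uj; rewrite !finset.inE finset.cards2 ij /= andbT.
apply/orP; case: (boolP ([set i; j]%SET \subset J)) => //=; last by left.
move=> /fintype.subsetP sJ; right.
have /imsetP[a _ ia] : i \in J by apply: sJ; rewrite finset.set21.
have /imsetP[b _ jb] : j \in J by apply: sJ; rewrite finset.set22.
have [ba|ba] := eqVneq b (opp a).
  apply/imsetP; subst i j b.
  case: a {ij ui uj sJ} => c; exists c => //.
  exact: finset.setUC.
subst i j.
(* As [a] and [b] are not opposite, both extremality conditions apply to the opposite points; they
   make the sum of the two values of [u] both positive and negative. *)
have ub : dot u (cross_pyramid (base (opp b))) < dot u (cross_pyramid (base a)).
  apply: ui; rewrite (inj_eq base_inj); apply: contra ba => /eqP <-.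
  by rewrite oppK.
have ua : dot u (cross_pyramid (base b)) < dot u (cross_pyramid (base (opp a))).
  by apply: uj; rewrite (inj_eq base_inj) eq_sym.
by move: ua ub; rewrite !cross_pyramid_opp !dotN; lra.
Qed.

End CrossPolytopePyramid.

(** * A simplex with one point just beyond each of [m] facets *)

Section StackedSimplex.
Variables (R : realType) (d m : nat).
Hypotheses (d3 : (2 < d)%N) (md : (m <= d)%N).

(** The point [inr j] is the centroid of the facet opposite the [j]-th unit vector, pushed out by
    [1/d] along the negative [j]-th axis. *)
Definition stacked_simplex (s : option 'I_d + 'I_m) : 'rV[R]_d :=
  match s with
  | inl None => 0
  | inl (Some i) => delta_mx 0 i
  | inr j => const_mx d%:R^-1 - (2 / d%:R) *: delta_mx 0 (widen_ord md j)
  end.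

Let d0 : 0 < d%:R :> R. Proof. by rewrite ltr0n; lia. Qed.
Let dge3 : 3 <= d%:R :> R. Proof. by rewrite (ler_nat R 3 d). Qed.

Let dot_apex u j : dot u (stacked_simplex (inr j)) =
  (\sum_i u 0 i - 2 * u 0 (widen_ord md j)) / d%:R.
Proof. by rewrite /= dotD dotN dotZ dot_const dot_delta; field; exact: lt0r_neq0. Qed.

Let sum_delta (l : 'I_d) : \sum_i (delta_mx 0 l : 'rV[R]_d) 0 i = 1.
Proof.
rewrite (bigD1 l)//= mxE !eqxx big1 ?addr0// => i il.
by rewrite mxE (negPf il) andbF.
Qed.

Lemma stacked_simplex_exposed s : exists u, forall t, t != s ->
  dot u (stacked_simplex t) < dot u (stacked_simplex s).
Proof.
case: s => [[i|]|a].
- exists (delta_mx 0 i) => -[[j|]|b] ts.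
  + have ji : j != i by apply: contra ts => /eqP->.
    by rewrite /= !dot_delta !mxE !eqxx (negPf ji).
  + by rewrite /= dot0r dot_delta mxE !eqxx.
  + rewrite dot_apex sum_delta /= dot_delta !mxE eqxx eqxx ltr_pdivrMr//=.
    by case: (_ == _) => /=; rewrite ?mulr1n ?mulr0n; move: dge3; lra.
- exists (- const_mx 1) => -[[j|]|b] ts //.
  + by rewrite /= dot0r dot_delta !mxE; move: dge3; lra.
  + rewrite dot_apex /= dot0r; under eq_bigr do rewrite !mxE.
    by rewrite !mxE sumr_const card_ord ltr_pdivrMr// mulNrn; move: dge3; lra.
- exists (- delta_mx 0 (widen_ord md a)) => t ts.
  have sumE : \sum_i (- delta_mx 0 (widen_ord md a) : 'rV[R]_d) 0 i = -1.
    by under eq_bigr do rewrite mxE; rewrite sumrN sum_delta.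
  rewrite dot_apex sumE !mxE !eqxx ltr_pdivlMr//=.
  case: t ts => [[j|]|b] ts.
  + by rewrite /= dot_delta !mxE !eqxx; case: (_ == _) => /=; move: dge3; lra.
  + by rewrite /= dot0r; move: dge3; lra.
  + have ba : b != a by apply: contra ts => /eqP->.
    rewrite dot_apex sumE !mxE /= -val_eqE /= val_eqE (negPf ba) /=.
    by rewrite divfK ?lt0r_neq0//; move: dge3; lra.
Qed.

Let X : {fset 'rV[R]_d} := points stacked_simplex.

Lemma stacked_simplex_Cs : Cs R d (d.+1 + m) X.
Proof.
have -> : (d.+1 + m)%N = #|{: option 'I_d + 'I_m}|.
  by rewrite card_sum card_option !card_ord.
apply: points_Cs; first exact: stacked_simplex_exposed.
  by rewrite card_sum card_option !card_ord; lia.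
apply: affine_hull_basis.
  by apply: sub_gen_smallest; exists (inl None).
by move=> i; apply: sub_gen_smallest; exists (inl (Some i)).
Qed.

(** With [u] maximal at apex [a], the unit vector [w] below it takes a value at most that of every
    point other than the apex, so no other point can be the strict minimum. *)
Lemma stacked_simplex_antipode u a j : 
  (forall l, l != inr a -> dot u (stacked_simplex l) < dot u (stacked_simplex (inr a))) ->
  (forall l, l != j -> dot u (stacked_simplex j) < dot u (stacked_simplex l)) ->
  j != inr a -> j = inl (Some (widen_ord md a)).
Proof.
move=> ua uj ja; apply/eqP; apply: contraT => jv.
set w := widen_ord md a in jv *.
have := uj (inl (Some w)); rewrite eq_sym jv => /(_ isT).
rewrite [dot u (stacked_simplex (inl _))]dot_delta ltNge => /negP[].
set M := dot u (stacked_simplex (inr a)) in ua.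
have ME : M * d%:R = \sum_i u 0 i - 2 * u 0 w.
  by rewrite /M dot_apex divfK ?lt0r_neq0.
have M0 : 0 < M by have := ua (inl None) isT; rewrite /= dot0r.
have uM l : u 0 l < M by have := ua (inl (Some l)) isT; rewrite /= dot_delta.
(* The gaps [M - u 0 i] are positive with a known sum; keeping only one or two of them bounds
   [u 0 w] above and the other coordinates below. *)
have dM : \sum_i (M - u 0 i) = - 2 * u 0 w.
  by rewrite sumrB sumr_const card_ord -(mulr_natr M) ME; ring.
have wM : u 0 w <= - M.
  have : M - u 0 w <= \sum_i (M - u 0 i).
    by rewrite (bigD1 w)//= lerDl sumr_ge0// => i _; rewrite subr_ge0 ltW.
  by rewrite dM; move: dge3; lra.
have lM l : l != w -> 2 * M + u 0 w <= u 0 l.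
  move=> lw.
  have : (M - u 0 w) + (M - u 0 l) <= \sum_i (M - u 0 i).
    rewrite (bigD1 w)//= (bigD1 l)//= addrA lerDl sumr_ge0// => i _.
    by rewrite subr_ge0 ltW.
  by rewrite dM; move: dge3; lra.
case: j jv ja {uj} => [[l|]|b] jv jb.
- rewrite /= dot_delta.
  have /lM : l != w by apply: contra jv => /eqP->.
  by move: dge3; lra.
- by rewrite /= dot0r; move: dge3; lra.
- have bw : widen_ord md b != w.
    by apply: contra jb; rewrite /w -val_eqE /= => /eqP/val_inj->.
  rewrite dot_apex ler_pdivlMr//.
  (* For another apex [b] the claim amounts to [2 u_b <= d (M - u_w) + 2 u_w]. As [d >= 3] and
     [u_w <= - M], the right side is at least [3 M - u_w >= 4 M], while [u_b < M]. *)
  have : 0 <= (M - u 0 w) * (d%:R - 3).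
    by apply: mulr_ge0; rewrite subr_ge0 ?(ltW (uM w)).
  by move: (uM (widen_ord md b)) (lM _ bw) M0 wM ME; lra.
Qed.

Lemma sa_stacked_simplex : (sa X <= 'C(d.+1, 2) + m)%N.
Proof.
(* [T] holds the pairs of simplex vertices, [D] the pairs of an apex and the vertex opposite its
   facet. *)
pose S : {set option 'I_d + 'I_m} := (inl @: [set: option 'I_d])%SET.
pose T : {set {set option 'I_d + 'I_m}} :=
  [set A : {set option 'I_d + 'I_m} | (A \subset S) && (#|A| == 2)]%SET.
pose D : {set {set option 'I_d + 'I_m}} :=
  [set [set inl (Some (widen_ord md j)); inr j]%SET | j : 'I_m]%SET.
have cT : #|T| = 'C(d.+1, 2).
  rewrite cards_draws card_imset ?cardsT ?card_option ?card_ord//.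
  by move=> a b [].
have cD : (#|D| <= m)%N by rewrite -[leqRHS]card_ord; exact: leq_imset_card.
apply: (@leq_trans #|(T :|: D)%SET|); last first.
  rewrite cardsU (leq_trans (leq_subr _ _))// cT.
  by rewrite leq_add2l.
apply: sa_points_le; first exact: stacked_simplex_exposed.
move=> i j u ij ui uj; rewrite !finset.inE finset.cards2 ij /= andbT.
apply/orP.
case: i ij ui uj => [i|a] ij ui uj; last first.
  rewrite (stacked_simplex_antipode ui uj) 1?eq_sym//.
  by right; apply/imsetP; exists a => //; exact: finset.setUC.
case: j ij ui uj => [j|a] ij ui uj; last first.
  (* Negating [u] exchanges maximum and minimum, which reduces to the previous case. *)
  right; rewrite (@stacked_simplex_antipode (- u) a (inl i))//.
  - by apply/imsetP; exists a.
  - by move=> l la; rewrite -scaleN1r !dotZl !mulN1r ltrN2 uj.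
  - by move=> l la; rewrite -scaleN1r !dotZl !mulN1r ltrN2 ui.
left; apply/fintype.subsetP => x; rewrite finset.in_set2 => /orP[] /eqP->.
  exact: imset_f.
exact: imset_f.
Qed.

End StackedSimplex.

(** * The two bounds and their orders of magnitude *)

Lemma natr_bin2 (R : realType) n : 'C(n, 2)%:R = n%:R * (n%:R - 1) / 2 :> R.
Proof.
elim: n => [|n IHn]; first by rewrite bin0n !mul0r.
by rewrite binS bin1 natrD IHn -natr1; field.
Qed.

Theorem theorem2p3 (R : realType) :
  (forall d k : nat, (2 <= k <= d - 1)%N -> Cs R d (d + k) !=set0) /\
  ((forall d k : nat, k_range_low R d k ->
      (sa_min R d (d + k))%:R <= d%:R * (d%:R + 1) / 2 + k%:R - 1 :> R) /\
   Theta_on R (k_range_low R)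
     (fun d k => d%:R * (d%:R + 1) / 2 + k%:R - 1) (fun d k => d%:R ^+ 2)) /\
  ((forall d k : nat, k_range_high R d k ->
      (sa_min R d (d + k))%:R <=
        k%:R + (d%:R + k%:R) * (d%:R + k%:R - 1) / 2
          - 2 * k%:R * (2 * k%:R - 1) / 2 :> R /\
      k%:R + (d%:R + k%:R) * (d%:R + k%:R - 1) / 2
          - 2 * k%:R * (2 * k%:R - 1) / 2 =
        k%:R + (d%:R - k%:R) * (d%:R + 3 * k%:R - 1) / 2 :> R) /\
   Theta_on R (k_range_high R)
     (fun d k => k%:R + (d%:R - k%:R) * (d%:R + 3 * k%:R - 1) / 2)
     (fun d k => (d%:R - k%:R) * d%:R)).
Proof.
have natr_range (d k : nat) : (2 <= k <= d - 1)%N -> 2 <= k%:R :> R /\ k%:R + 1 <= d%:R :> R.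
  by move=> dk; rewrite natr1 !ler_nat; lia.
split=> [d k dk|].
  have [k0 kd] : (0 < k)%N /\ (k <= d)%N by lia.
  by exists (points (cross_pyramid R kd)); exact: cross_pyramid_Cs.
split; split.
- move=> d k [dk _].
  (* The simplex already has [d + 1] vertices, so [k - 1] points are added. *)
  have [d3 md] : (2 < d)%N /\ (k.-1 <= d)%N by lia.
  have := stacked_simplex_Cs R d3 md.
  rewrite (_ : d.+1 + k.-1 = d + k)%N; last lia.
  move=> /sa_min_le/leq_trans/(_ (sa_stacked_simplex R d3 md)).
  rewrite -(ler_nat R) => /le_trans; apply.
  rewrite natrD natr_bin2 -natr1 -subn1 natrB; last lia.
  by lra.
(* Since [k - 1 <= d], the bound lies between [d^2 / 2] and [d (d + 1) / 2 + d <= 2 d^2]. *)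
- exists (1 / 2), 2; split; [lra|lra|move=> d k [/natr_range[k2 kd] _]].
  by apply/andP; split; nra.
- move=> d k [dk _]; split; last by field.
  have [k0 kd] : (0 < k)%N /\ (k <= d)%N by lia.
  have := cross_pyramid_Cs R k0 kd.
  move=> /sa_min_le/leq_trans/(_ (sa_cross_pyramid R kd)).
  (* The truncated difference of binomials is exact because [2 k <= d + k]. *)
  rewrite -(ler_nat R) => /le_trans; apply.
  rewrite natrD natrB ?natr_bin2 ?natrD ?natrM; last by apply: leq_bin2l; lia.
  by lra.
(* The factor [d + 3 k - 1] lies between [d] and [4 d], and [k <= d <= (d - k) d] because
   [d - k >= 1]. *)
- exists (1 / 2), 3; split; [lra|lra|move=> d k [/natr_range[k2 kd] _]].
  by apply/andP; split; nra.
Qed.
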